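(* Let $\mathcal{H}$ be a finite-dimensional real Hilbert space, $\mathcal{X}\subset\mathcal{H}$, $\gamma\in(0,1)$, and $\beta=\frac{1}{1-\gamma}$. Let $P$ be a $\gamma$-homogeneous coercive operator on $\mathcal{X}$ such that $-P$ is maximally monotone and $P(0)=0$. Let $\mathcal{K}=\{e\in\mathcal{X}:P(e)=0\}$ be its kernel, and assume the flow $u_t(t)=P(u(t))$ is mass preserving. Let $f\in\mathcal{K}^\perp$, $f\ne0$, be an eigenfunction of $P$ with eigenvalue $\lambda$, i.e. $P(f)=\lambda f$. Let $u$ be the (unique) solution of $$u_t(t)=P(u(t)),\qquad u(0)=f,$$ and let $b$ be greater than the extinction time of $u$. Then the $p$-transform of $f$, $$\phi(t)=\frac{t^{\beta}}{\Gamma(\beta+1)}\,D^{\beta+1}_{b^-}\{u\}(t),$$ is given by $$\phi(t)=f\cdot t^{\beta}\left[(\gamma-1)\lambda\right]^{\beta+1}\cdot\delta\bigl(1-(\gamma-1)\lambda\, t\bigr),$$ where $\delta$ is the Dirac delta function.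
   Context: Monotonicity: an operator $Q$ on $\mathcal{X}$ is monotone if $\langle Q(u)-Q(v),u-v\rangle\ge0$ for all $u,v\in\mathcal{X}$. It is maximally monotone if it admits no proper monotone extension. Homogeneity: $P$ is $\gamma$-homogeneous if $P(cu)=c|c|^{\gamma-1}P(u)$ for all $c\in\mathbb{R}$ (right-hand side read as $0$ when $c=0$). Orthogonal complement: $\mathcal{K}^\perp=\{w\in\mathcal{X}:\langle w,e\rangle=0\ \forall e\in\mathcal{K}\}$. Coercivity: $P$ is coercive if there is $C>0$ with $\|u\|^{\gamma+1}\le C\langle -P(u),u\rangle$ for all $u\in\mathcal{K}^\perp$. Mass preservation: the flow is mass preserving if every solution satisfies $\langle u(t),e\rangle=\text{const}$ in $t$ for all $e\in\mathcal{K}$. Solutions of the flow are assumed to exist for $t\ge0$, to be unique, and to be differentiable in $t$. Extinction time: the minimal $T>0$ such that $u_t(t)=0$ for all $t\ge T$. Fractional operators in the variable $t\in[0,b]$ (right-sided Riemann–Liouville): for $\alpha>0$, $$I^{\alpha}_{b^-}\{y\}(t)=\frac{1}{\Gamma(\alpha)}\int_t^b(\tau-t)^{\alpha-1}y(\tau)\,d\tau ,$$ and $I^0_{b^-}$ is the identity. For $\alpha\geq0$, $$D^{\alpha}_{b^-}\{y\}(t)=(-1)^{\lceil\alpha\rceil}\frac{d^{\lceil\alpha\rceil}}{dt^{\lceil\alpha\rceil}}\,I^{\lceil\alpha\rceil-\alpha}_{b^-}\{y\}(t),$$ with $\lceil\alpha\rceil$ the ceiling of $\alpha$. They are applied to vector-valued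 functions componentwise. In the claim, the derivatives, the products and the equality are understood in the sense of ($\mathcal{H}$-valued) distributions in $t$ on $(0,b)$. For $c>0$, $\delta(1-ct)$ denotes the usual composition, i.e. $\frac1c$ times the Dirac delta at $t=\frac1c$. *)

(* Defs.v *)
From HB Require Import structures.
From mathcomp Require Import all_boot all_order all_algebra.
From mathcomp Require Export sesquilinear.
From mathcomp Require Import all_classical all_reals all_analysis.

Set Implicit Arguments.
Unset Strict Implicit.
Unset Printing Implicit Defensive.

Import Order.TTheory GRing.Theory Num.Theory.
Import numFieldNormedType.Exports.

Local Open Scope classical_set_scope.
Local Open Scope ring_scope.

(* Finite-dimensional normed spaces.  A finite-dimensional real Hilbert space
   is such a space H with a form [ip : {dot H for idfun}] (symmetric, bilinear,
   positive definite) inducing the norm, see [norm_of]. *)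
#[short(type="normedVectType")]
HB.structure Definition NormedVector (R : numDomainType) :=
  {H of NormedModule R H & Vector R H}.

Section Hilbert.
Context {R : realType} {H : normedVectType R}.
Implicit Types (ip : {dot H for idfun}) (A B : set (H * H)).

Definition norm_of ip := forall x : H, `|x| ^+ 2 = ip x x.

(* Operators are single-valued maps on their domain X; only the values on X of
   the underlying total function matter. Monotone extensions may be
   multivalued, so maximality is phrased on graphs in H * H. *)
Definition graph (X : set H) (Q : H -> H) : set (H * H) :=
  [set p | X p.1 /\ p.2 = Q p.1].

Definition monotone_graph ip A :=
  forall p q, A p -> A q -> 0 <= ip (p.2 - q.2) (p.1 - q.1).

Definition maximally_monotone ip (X : set H) (Q : H -> H) :=
  monotone_graph ip (graph X Q) /\
  forall B, monotone_graph ip B -> graph X Q `<=` B -> B = graph X Q.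

(* At c = 0 the factor [c * ...] vanishes, whatever [0 `^ (gamma - 1)] is. *)
Definition homogeneous (gamma : R) (X : set H) (P : H -> H) :=
  forall (c : R) (u : H), X u ->
    X (c *: u) /\ P (c *: u) = (c * `|c| `^ (gamma - 1)) *: P u.

Definition op_kernel (X : set H) (P : H -> H) : set H :=
  [set e | X e /\ P e = 0].

Definition ortho_compl ip (X K : set H) : set H :=
  [set w | X w /\ forall e, K e -> ip w e = 0].

Definition coercive ip (gamma : R) (X : set H) (P : H -> H) :=
  exists2 C : R, 0 < C &
    forall u, ortho_compl ip X (op_kernel X P) u ->
      `|u| `^ (gamma + 1) <= C * ip (- P u) u.

(* Solutions live on [0, +oo[ (values of u at negative times are irrelevant),
   so the time derivative at 0 is the right derivative. *)
Definition is_solution (X : set H) (P : H -> H) (u : R -> H) :=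
  [/\ forall t : R, 0 <= t -> X (u t),
      h^-1 *: (u h - u 0) @[h --> 0^'+] --> P (u 0)
    & forall t : R, 0 < t -> is_derive t 1 u (P (u t))].

Definition well_posed (X : set H) (P : H -> H) :=
  forall u0, X u0 ->
    (exists2 u, is_solution X P u & u 0 = u0) /\
    (forall u v, is_solution X P u -> is_solution X P v ->
       u 0 = u0 -> v 0 = u0 -> forall t : R, 0 <= t -> u t = v t).

Definition mass_preserving ip (X : set H) (P : H -> H) :=
  forall u, is_solution X P u ->
    forall e, op_kernel X P e -> forall t : R, 0 <= t -> ip (u t) e = ip (u 0) e.

Definition steady_from (u : R -> H) (T : R) :=
  0 < T /\ forall t, T <= t -> derive1 u t = 0.

Definition is_extinction_time (u : R -> H) (T : R) :=
  steady_from u T /\ forall T', steady_from u T' -> T <= T'.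

Definition is_eigenfunction (P : H -> H) (f : H) (lambda : R) :=
  f != 0 /\ P f = lambda *: f.

End Hilbert.

(* Vector-valued distributions in t on (0, b), given by their action on test
   functions; two of them are equal when they agree on all test functions. *)
Section Distributions.
Context {R : realType}.

Definition test_function (b : R) (psi : R -> R) :=
  [/\ forall n (t : R), derivable (derive1n n psi) t 1,
      compact (closure [set t | psi t != 0])
    & closure [set t | psi t != 0] `<=` `]0, b[].

Definition distr (V : Type) := (R -> R) -> V.

Definition eq_distr (b : R) (V : Type) (S1 S2 : distr V) :=
  forall psi, test_function b psi -> S1 psi = S2 psi.

(* Product by a function that is smooth on (0, b). *)
Definition distr_mul (V : Type) (a : R -> R) (S : distr V) : distr V :=
  fun psi => S (fun t => a t * psi t).

Definition distr_scale (V : lmodType R) (k : R) (S : distr V) : distr V :=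
  fun psi => k *: S psi.

Definition distr_deriv (V : lmodType R) (S : distr V) : distr V :=
  fun psi => - S (derive1 psi).

Definition distr_vec (V : lmodType R) (v : V) (S : distr R) : distr V :=
  fun psi => S psi *: v.

Definition dirac_at (a : R) : distr R := fun psi => psi a.

(* delta (1 - c t), meaningful for c > 0 *)
Definition dirac_1sub (c : R) : distr R :=
  distr_scale c^-1 (dirac_at c^-1).

End Distributions.

Section Fractional.
Context {R : realType} {H : normedVectType R}.
Local Notation mu := (@lebesgue_measure R).

Definition Gamma (x : R) : R :=
  \int[mu]_(s in `]0%R, +oo[) (s `^ (x - 1) * expR (- s)).

(* Componentwise integral; it does not depend on the choice of the basis. *)
Definition vint (D : set R) (g : R -> H) : H :=
  \sum_(i < \dim {:H})
    (\int[mu]_(t in D) coord (vbasis {:H}) i (g t)) *: (vbasis {:H})`_i.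

Definition distr_of_fun (b : R) (y : R -> H) : distr H :=
  fun psi => vint `]0, b[ (fun t => psi t *: y t).

Definition frac_int (alpha b : R) (y : R -> H) (t : R) : H :=
  if alpha == 0 then y t
  else (Gamma alpha)^-1 *:
         vint `]t, b[ (fun tau => (tau - t) `^ (alpha - 1) *: y tau).

Definition frac_deriv (alpha b : R) (y : R -> H) : distr H :=
  let n := `|Num.ceil alpha|%N in
  distr_scale ((-1) ^+ n)
    (iter n (@distr_deriv R H)
       (distr_of_fun b (frac_int (n%:R - alpha) b y))).

(* The transform of the datum [u 0], [u] being the solution of the flow. *)
Definition p_transform (beta b : R) (u : R -> H) : distr H :=
  distr_mul (fun t => t `^ beta / Gamma (beta + 1))
    (frac_deriv (beta + 1) b u).

End Fractional.

(* Main.v *)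
Require Import Defs.
From HB Require Import structures.
From mathcomp Require Import all_boot all_order all_algebra.
From mathcomp Require Import all_classical all_reals all_analysis.
From mathcomp Require Import measurable_realfun ring lra.
Import Order.TTheory GRing.Theory Num.Theory.
Import numFieldNormedType.Exports.
Local Open Scope classical_set_scope.
Local Open Scope ring_scope.

Set Implicit Arguments.
Unset Strict Implicit.

(* Coercivity forces lambda < 0, so c = (gamma - 1) * lambda > 0; put s = 1/c.
   By homogeneity u(t) = (1 - c t)_+^beta f = c^beta (s - t)_+^beta f solves the
   flow, hence is the solution, and it vanishes exactly from t = s on, so s < b.
   With n + 1 the ceiling of beta + 1, the Beta integral gives
   I^{n - beta} u = c^beta Gamma(beta + 1) / n! (s - t)_+^n f, and by Taylor's
   formula with integral remainder the (n + 1)-st distributional derivative of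
   (s - t)_+^n / n! is, up to the sign (-1)^(n + 1), the Dirac mass at s. *)

(** * Euler's Gamma and Beta integrals and their product formula *)

Section euler_integrals.
Context {R : realType}.
Local Notation mu := (@lebesgue_measure R).
Local Open Scope ereal_scope.

(** Scaled by [a], the pushforward of [mu] under the affine map gives every interval []x, y]] its
    length, and this determines Lebesgue measure. *)
Lemma lebesgue_measure_affine (a c : R) (A : set (measurableTypeR R)) :
  (0 < a)%R -> measurable A ->
  mu ((fun x : measurableTypeR R => a * x + c : measurableTypeR R)%R @^-1` A)
  = (a^-1)%:E * mu A.
Proof.
move=> a0 mA.
pose phi : measurableTypeR R -> measurableTypeR R := (fun x => a * x + c)%R.
have mphi : measurable_fun setT phi.
  by apply: measurable_funD => //; exact: measurable_funM.
suff -> : mu A = mscale (NngNum (ltW a0)) (pushforward mu phi) A.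
  by rewrite /mscale/= muleA -EFinM mulVf ?gt_eqF// mul1e.
pose pf := [the {measure set measurableTypeR R -> \bar R} of
  pushforward mu phi].
pose nu := [the {measure set measurableTypeR R -> \bar R} of
  mscale (NngNum (ltW a0)) (pf mphi)].
suff h : forall X, ocitv X -> mu X = nu X.
  by rewrite (@lebesgue_measure_unique R nu h A mA).
move=> _ [[x y]] _ <-.
rewrite -[RHS]/(a%:E * mu (phi @^-1` `]x, y]%classic)).
have -> : phi @^-1` `]x, y] = `]((x - c) / a)%R, ((y - c) / a)%R]%classic.
  apply/seteqP; split=> z /=; rewrite !in_itv/= /phi ltr_pdivrMr// ler_pdivlMr//.
    by rewrite ltrBlDr lerBrDr mulrC.
  by rewrite ltrBlDr lerBrDr mulrC.
rewrite !lebesgue_measure_itv/= !lte_fin ltr_pM2r ?invr_gt0// ltrD2r.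
case: ifP => _; last by rewrite mule0.
by rewrite -!EFinB -EFinM; congr EFin; field; rewrite gt_eqF.
Qed.

Lemma ge0_integral_affine (a c : R) (D : set R) (f : R -> \bar R) :
  (0 < a)%R -> measurable D -> measurable_fun D f ->
  (forall x, D x -> 0 <= f x) ->
  \int[mu]_(x in (fun x => a * x + c)%R @^-1` D) f (a * x + c)%R
  = (a^-1)%:E * \int[mu]_(x in D) f x.
Proof.
move=> a0 mD mf f0.
pose phi : measurableTypeR R -> measurableTypeR R := (fun x => a * x + c)%R.
have mphi : measurable_fun setT phi.
  by apply: measurable_funD => //; exact: measurable_funM.
have ai0 : (0 <= a^-1)%R by rewrite invr_ge0 ltW.
have -> : (a^-1)%:E * \int[mu]_(x in D) f x =
    \int[mscale (NngNum ai0) mu]_(x in D) f x.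
  by rewrite ge0_integral_mscale.
rewrite -(@ge0_integral_pushforward _ _ _ _ _ phi mphi mu D f)//; last first.
  by move=> x; rewrite inE; exact: f0.
apply: eq_measure_integral => //= A mA AD.
rewrite -[RHS]/((a^-1)%:E * mu A).
exact: (lebesgue_measure_affine c a0 mA).
Qed.

Lemma measurable_fun_powR d (T : measurableType d) (D : set T) (g : T -> R)
    (r : R) : measurable_fun D g -> measurable_fun D (fun x => g x `^ r)%R.
Proof. by move=> mg; exact: (measurableT_comp (measurable_powR r) mg). Qed.

Lemma measurable_fun_expR d (T : measurableType d) (D : set T) (g : T -> R) :
  measurable_fun D g -> measurable_fun D (fun x => expR (g x))%R.
Proof. by move=> mg; exact: (measurableT_comp (@measurable_expR R) mg). Qed.

(** The truncated power $x_+^{p-1}$. The cut-off is explicit because [powR] does not vanish on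
    negative reals; it turns Beta integrals into convolutions over the whole line. *)
Definition power_tail (p x : R) : R := if (0 < x)%R then (x `^ (p - 1))%R else 0%R.

(* Extended-real integrals, so that Tonelli yields [Gamma_eM] with no
   convergence hypothesis; [Gamma p] is convertible to [fine (Gamma_e p)]. *)
Definition Gamma_e (p : R) : \bar R :=
  \int[mu]_(s in `]0%R, +oo[) (s `^ (p - 1) * expR (- s))%:E.

Definition Beta_e (p q : R) : \bar R :=
  \int[mu]_(v in `]0%R, 1%R[) (v `^ (p - 1) * (1 - v) `^ (q - 1))%:E.

Lemma power_tail_ge0 p x : (0 <= power_tail p x)%R.
Proof. by rewrite /power_tail; case: ifP => // _; exact: powR_ge0. Qed.

Lemma measurable_power_tail p : measurable_fun setT (power_tail p).
Proof.
by apply: measurable_fun_ifT => //; exact: measurable_fun_ltr.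
Qed.

Lemma measurable_fun_power_tail d (T : measurableType d) (g : T -> R) (p : R) :
  measurable_fun setT g -> measurable_fun setT (fun x => power_tail p (g x)).
Proof. by move=> mg; exact: (measurableT_comp (measurable_power_tail p) mg). Qed.

Lemma powRM_sub1 (x r : R) : (0 < x)%R -> (x * x `^ (r - 1) = x `^ r)%R.
Proof.
move=> x0; have x1 : (x != 0)%R by rewrite gt_eqF.
by rewrite powRB ?x1 ?implybT// powRr1 ?(ltW x0)// mulrC divfK.
Qed.

(** Under $x = t + (s-t)v$ the integrand is homogeneous of degree $p+q-2$ in $s-t$, and the Jacobian
    contributes one more power. *)
Lemma Beta_e_itv (p q t s : R) : (t < s)%R ->
  \int[mu]_(x in `]t, s[) ((x - t) `^ (p - 1) * (s - x) `^ (q - 1))%:E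
  = ((s - t) `^ (p + q - 1))%:E * Beta_e p q.
Proof.
move=> ts; have st0 : (0 < s - t)%R by rewrite subr_gt0.
have mf : measurable_fun setT
    (fun x : R => ((x - t) `^ (p - 1) * (s - x) `^ (q - 1))%:E).
  apply/measurable_EFinP; apply: measurable_funM.
    apply: measurable_fun_powR.
    exact: measurable_funB.
  apply: measurable_fun_powR.
  exact: measurable_funB.
pose F (v : R) := ((v `^ (p - 1) * (1 - v) `^ (q - 1))%:E).
have mF : measurable_fun setT F.
  apply/measurable_EFinP; apply: measurable_funM.
    exact: measurable_powR.
  apply: measurable_fun_powR.
  exact: measurable_funB.
have f0 (x : R) : `]t, s[%classic x ->
    0 <= ((x - t) `^ (p - 1) * (s - x) `^ (q - 1))%:E.
  by move=> _; rewrite lee_fin mulr_ge0 ?powR_ge0.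
have := @ge0_integral_affine (s - t)%R t `]t, s[ _ st0 (measurable_itv _)
  (measurable_funTS mf) f0.
have -> : (fun x => (s - t) * x + t)%R @^-1` `]t, s[ = `]0%R, 1%R[%classic.
  apply/seteqP; split=> z /=; rewrite !in_itv/=.
    move=> /andP[h1 h2]; apply/andP; split; first by nra.
    by rewrite -(ltr_pM2l st0); nra.
  by move=> /andP[h1 h2]; apply/andP; split; nra.
rewrite [X in X = _ -> _](_ : _ = \int[mu]_(v in `]0%R, 1%R[)
    (((s - t) `^ (p + q - 1 - 1))%:E * F v)); last first.
  apply: eq_integral => x; rewrite inE/= in_itv/= => /andP[x0 x1].
  rewrite /F -EFinM; congr EFin.
  rewrite (_ : (s - t) * x + t - t = (s - t) * x)%R; last by ring.
  rewrite (_ : s - ((s - t) * x + t) = (s - t) * (1 - x))%R; last by ring.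
  rewrite !powRM ?subr_ge0 ?(ltW x0) ?(ltW x1) ?(ltW ts) //.
  rewrite (_ : p + q - 1 - 1 = (p - 1) + (q - 1))%R; last by ring.
  by rewrite [in RHS]powRD ?(gt_eqF st0) ?implybT// mulrACA.
have F0 x : `]0%R, 1%R[%classic x -> 0 <= F x.
  by move=> _; rewrite lee_fin mulr_ge0 ?powR_ge0.
have k0 : 0 <= ((s - t) `^ (p + q - 1 - 1))%:E by rewrite lee_fin powR_ge0.
rewrite ge0_integralZl; [|exact: measurable_itv|exact: measurable_funTS|exact: F0|exact: k0].
rewrite -[\int[mu]_(x in `]0%R, 1%R[) F x]/(Beta_e p q) => h.
have st1 : (s - t != 0)%R by rewrite gt_eqF.
have := congr1 (fun z => (s - t)%:E * z) h.
rewrite [RHS]muleA -EFinM (mulfV st1) mul1e => <-; rewrite muleA -EFinM.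
by rewrite (powRM_sub1 _ st0).
Qed.

(** The convolution behind [Gamma_eM]. For $r \le 0$ the two factors are never both nonzero. *)
Lemma power_tail_conv (p q r : R) :
  \int[mu]_x (power_tail p x * power_tail q (r - x))%:E
  = (power_tail (p + q) r)%:E * Beta_e p q.
Proof.
have [r0|r0] := ltP 0%R r; last first.
  rewrite /power_tail (ltNge 0%R r) r0/= mul0e integral0_eq// => x _.
  case: ifPn => [x0|_]; last by rewrite mul0r.
  by rewrite ifF ?mulr0//; apply/negbTE; rewrite -leNgt; lra.
rewrite [in RHS]/power_tail r0 -[X in (X `^ _)%:E]subr0 -Beta_e_itv//.
rewrite [RHS]integral_mkcond; apply: eq_integral => x _.
rewrite patchE /power_tail; case: (boolP (x \in `]0%R, r[%classic)).
  by rewrite inE/= in_itv/= => /andP[x0 xr]; rewrite x0 subr_gt0 xr subr0.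
move=> xr; case: ifPn => [x0|_]; last by rewrite mul0r.
rewrite ifF ?mulr0// subr_gt0; apply/negbTE; apply: contra xr => xr.
by rewrite inE/= in_itv/= x0.
Qed.

Lemma Gamma_eE (p : R) :
  Gamma_e p = \int[mu]_x (power_tail p x * expR (- x))%:E.
Proof.
rewrite /Gamma_e integral_mkcond; apply: eq_integral => x _.
rewrite patchE /power_tail; case: (boolP (x \in `]0%R, +oo[%classic)).
  by rewrite inE/= in_itv/= andbT => ->.
by move=> x0; rewrite ifF ?mul0r//; apply/negbTE; apply: contra x0 => x0;
  rewrite inE/= in_itv/= x0.
Qed.

Lemma measurable_power_tailM (p : R) :
  measurable_fun setT (fun x => (power_tail p x * expR (- x))%:E).
Proof.
apply/measurable_EFinP; apply: measurable_funM; first exact: measurable_power_tail.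
exact: measurable_fun_expR.
Qed.

(** Classical double-integral argument: shift $y$ by $x$ so that the exponentials combine into
    $e^{-y}$, exchange the integrals by Tonelli, and recognise the inner integral in $x$ as a
    convolution of truncated powers. *)
Lemma Gamma_eM (p q : R) :
  Gamma_e p * Gamma_e q = Beta_e p q * Gamma_e (p + q).
Proof.
pose f (z : measurableTypeR R * measurableTypeR R) :=
  (power_tail p z.1 * power_tail q (z.2 - z.1) * expR (- z.2))%:E.
have mf : measurable_fun setT f.
  apply/measurable_EFinP; apply: measurable_funM; first apply: measurable_funM.
  - exact: measurable_fun_power_tail.
  - apply: measurable_fun_power_tail.
    exact: measurable_funB.
  - apply: measurable_fun_expR.
    exact: measurableT_comp.
have f0 z : 0 <= f z by rewrite lee_fin !mulr_ge0 ?power_tail_ge0 ?expR_ge0.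
transitivity (\int[mu]_x \int[mu]_y f (x, y)).
  rewrite [X in X * _]Gamma_eE -ge0_integralZr//; last 3 first.
  - exact: measurable_power_tailM.
  - by move=> x _; rewrite lee_fin mulr_ge0 ?power_tail_ge0 ?expR_ge0.
  - by apply: integral_ge0 => x _; rewrite lee_fin mulr_ge0 ?powR_ge0 ?expR_ge0.
  apply: eq_integral => x _.
  rewrite Gamma_eE.
  have := @ge0_integral_affine 1 (- x) setT _ ltr01 measurableT
    (measurable_power_tailM q).
  rewrite preimage_setT invr1 mul1e => <-; last first.
    by move=> y _; rewrite lee_fin mulr_ge0 ?power_tail_ge0 ?expR_ge0.
  rewrite -ge0_integralZl//; last 3 first.
  - apply: (measurableT_comp (measurable_power_tailM q)).
    by apply: measurable_funD => //; exact: measurable_funM.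
  - by move=> y _; rewrite lee_fin mulr_ge0 ?power_tail_ge0 ?expR_ge0.
  - by rewrite lee_fin mulr_ge0 ?power_tail_ge0 ?expR_ge0.
  apply: eq_integral => y _; rewrite /f -EFinM /= mul1r; congr EFin.
  rewrite mulrACA -expRD; congr (_ * expR _)%R; ring.
rewrite (fubini_tonelli f)// Gamma_eE -ge0_integralZl//; last 3 first.
- exact: measurable_power_tailM.
- by move=> x _; rewrite lee_fin mulr_ge0 ?power_tail_ge0 ?expR_ge0.
- by apply: integral_ge0 => x _; rewrite lee_fin mulr_ge0 ?powR_ge0.
apply: eq_integral => y _; rewrite EFinM muleA [X in X * _]muleC -power_tail_conv.
rewrite -ge0_integralZr ?lee_fin ?expR_ge0//.
- apply/measurable_EFinP; apply: measurable_funM; first exact: measurable_power_tail.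
  apply: measurable_fun_power_tail.
  exact: measurable_funB.
- by move=> x _; rewrite lee_fin mulr_ge0 ?power_tail_ge0.
Qed.

End euler_integrals.

Lemma is_derive_congr {R : realType} {V : normedModType R} (F : R -> V) (x : R)
    (df df' : V) : is_derive x 1 F df -> df = df' -> is_derive x 1 F df'.
Proof. by move=> ? <-. Qed.

(** * Values, positivity and finiteness of the Euler integrals *)

Section euler_values.
Context {R : realType}.
Local Notation mu := (@lebesgue_measure R).

Lemma is_derive_FTC2 (F f : R -> R) (a b : R) : a < b ->
  (forall x, a <= x -> x <= b -> is_derive x 1 F (f x)) ->
  (forall x, a <= x -> x <= b -> {for x, continuous f}) ->
  (\int[mu]_(x in `[a, b]) (f x)%:E = (F b - F a)%:E)%E.
Proof.
move=> ab dF cf; rewrite EFinB; apply: continuous_FTC2 => //.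
- apply: continuous_in_subspaceT => x; rewrite inE/= in_itv/= => /andP[ax xb].
  exact: cf.
- have cF x : a <= x -> x <= b -> {for x, continuous F}.
    move=> ax xb; apply: differentiable_continuous; apply/derivable1_diffP.
    by have [] := dF _ ax xb.
  split.
  + move=> x; rewrite in_itv/= => /andP[/ltW ax /ltW xb].
    by have [] := dF _ ax xb.
  + by apply: cvg_at_right_filter; apply: cF => //; exact: ltW.
  + by apply: cvg_at_left_filter; apply: cF => //; exact: ltW.
- move=> x; rewrite in_itv/= => /andP[/ltW ax /ltW xb].
  by have [_] := dF _ ax xb; rewrite derive1E.
Qed.

Local Open Scope ereal_scope.

(** The primitive $v^a/a$ is used only away from the singularity at 0: compact intervals exhaust the
    domain, and monotone convergence passes to the limit. *)
Lemma integral_powR_le (a : R) : (0 < a)%R ->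
  \int[mu]_(v in `]0%R, 1%R[) (v `^ (a - 1))%:E <= (a^-1)%:E.
Proof.
move=> a0.
(* Starting at $1/(n+2)$ keeps every interval nondegenerate, even for $n = 0$. *)
pose F (n : nat) : set R := `[(n.+2%:R^-1)%R, 1%R]%classic.
have ndF : nondecreasing_seq F.
  move=> m n mn; rewrite subsetEset => x; rewrite /F/= !in_itv/= => /andP[h ->].
  by rewrite andbT (le_trans _ h)// lef_pV2 ?posrE// ler_nat.
have mf D : measurable_fun D (fun v : R => (v `^ (a - 1))%:E).
  by apply/measurable_EFinP; apply: measurable_fun_powR.
have mF i : measurable (F i) by exact: measurable_itv.
have FE n : \int[mu]_(v in F n) (v `^ (a - 1))%:E <= (a^-1)%:E.
  have n0 : (0 < n.+2%:R^-1 :> R)%R by rewrite invr_gt0.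
  rewrite [leLHS](_ : _ = (a^-1 * 1 `^ a - a^-1 * n.+2%:R^-1 `^ a)%:E); last first.
    apply: (@is_derive_FTC2 (fun x => a^-1 * x `^ a)%R).
    - by rewrite invf_lt1// ltr1n.
    - move=> x nx _; have x0 : (0 < x)%R by exact: lt_le_trans nx.
      have h := is_derive1_powR a x0.
      apply: is_derive_eq.
      by rewrite /GRing.scale/= mulrA mulVf ?mul1r// gt_eqF.
    - move=> x nx _; have x0 : (0 < x)%R by exact: lt_le_trans nx.
      apply: differentiable_continuous; apply/derivable1_diffP.
      by apply: derivable_powR; rewrite in_itv/= x0.
  rewrite powR1 mulr1 lee_fin lerBlDr lerDl mulr_ge0 ?powR_ge0//.
  by rewrite invr_ge0 ltW.
have f0 i x : F i x -> 0 <= (x `^ (a - 1))%:E by rewrite lee_fin powR_ge0.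
have h : \int[mu]_(v in F i) (v `^ (a - 1))%:E @[i --> \oo] -->
    \int[mu]_(v in \bigcup_i F i) (v `^ (a - 1))%:E.
  apply: ge0_nondecreasing_set_cvg_integral => // i; exact: mf.
apply: (@le_trans _ _ (\int[mu]_(v in \bigcup_i F i) (v `^ (a - 1))%:E)).
  apply: ge0_subset_integral => //.
  - by apply: bigcup_measurable => i _; exact: mF.
  - exact: mf.
  - by move=> x [i _]; exact: f0.
  - move=> x; rewrite /= in_itv/= => /andP[x0 x1].
    (* With $n = \lfloor 1/x \rfloor$ one has $1/x < n+1 < n+2$, so $x$ lies in [F n]. *)
    exists (Num.truncn x^-1) => //; rewrite /F/= in_itv/= (ltW x1) andbT.
    rewrite invf_ple ?posrE// ltW// (lt_trans (truncnS_gt _))// ltr_nat.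
    by rewrite ltnS.
rewrite -(cvg_lim _ h)//; apply: lime_le; first by apply/cvg_ex; eexists; exact: h.
exact: nearW.
Qed.

(** This is the total mass of the exponential density of rate 1. *)
Lemma Gamma_e1 : Gamma_e (1 : R) = 1.
Proof.
rewrite -(integral_exponential_pdf ltr01) /Gamma_e /exponential_pdf.
have -> : (fun x => (((fun x0 : R => 1 * expR (-1 * x0)) \_ `[0%R, +oo[) x)%:E)%R =
  (fun x => ((EFin \o (fun x0 : R => 1 * expR (-1 * x0))%R) \_ `[0%R, +oo[) x).
  by apply/funext => x; rewrite !patchE; case: ifP.
rewrite -integral_mkcond -integral_itv_obnd_cbnd; last first.
  apply/measurable_EFinP; apply: measurable_funM => //.
  by apply: measurable_fun_expR; exact: measurable_funM.
by apply: eq_integral => x _ /=; rewrite subrr powRr0 mulN1r.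
Qed.

Lemma Beta_e1S (n : nat) : Beta_e (1 : R) n.+1%:R = (n.+1%:R^-1)%:E.
Proof.
have mf D : measurable_fun D (fun v : R => ((1 - v) ^+ n)%:E).
  by apply/measurable_EFinP; apply: measurable_funX; exact: measurable_funB.
transitivity (\int[mu]_(v in `]0%R, 1%R[) ((1 - v) ^+ n)%:E).
  apply: eq_integral => v; rewrite inE/= in_itv/= => /andP[v0 v1].
  by rewrite subrr powRr0 mul1r -natr1 addrK powR_mulrn// subr_ge0 ltW.
rewrite integral_itv_obnd_cbnd// integral_itv_bndo_bndc//.
rewrite -beta_fun1Sn EFin_beta_fun integral_XMonemX_restrict setTI.
by apply: eq_integral => v _; rewrite XMonemX0n.
Qed.

(** Taking $p = 1$ in [Gamma_eM] gives $\Gamma(n+1) = \Gamma(n+2)/(n+1)$, the factorial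
    recursion. *)
Lemma Gamma_eS (n : nat) : Gamma_e (n.+1%:R : R) = (n`!%:R)%:E.
Proof.
elim: n => [|n IH]; first by rewrite Gamma_e1.
have := Gamma_eM 1 (n.+1%:R : R); rewrite Gamma_e1 mul1e IH Beta_e1S.
rewrite (_ : 1 + n.+1%:R = n.+2%:R)%R => [|]; last by rewrite -[RHS]natr1 addrC.
move=> /(congr1 (fun x => n.+1%:R%:E * x)).
rewrite muleA -!EFinM mulfV ?pnatr_eq0// mul1e => <-.
by rewrite factS natrM.
Qed.

Lemma Gamma_e_gt0 (p : R) : 0 < Gamma_e p.
Proof.
(* On $[1,2]$, $0 \le \ln s \le 1$ gives $s^{p-1} \ge e^{-|p-1|}$, and $e^{-s} \ge e^{-2}$; [k] is
   the product of these bounds. *)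
pose k : R := (expR (- `|p - 1|) * expR (-2))%R.
have k0 : (0 < k)%R by rewrite mulr_gt0 ?expR_gt0.
have mf D : measurable_fun D (fun s : R => (s `^ (p - 1) * expR (- s))%:E).
  apply/measurable_EFinP; apply: measurable_funM; first exact: measurable_fun_powR.
  exact: measurable_fun_expR.
have f0 (s : R) : 0 <= (s `^ (p - 1) * expR (- s))%:E.
  by rewrite lee_fin mulr_ge0 ?powR_ge0 ?expR_ge0.
apply: (@lt_le_trans _ _ (\int[mu]_(s in `[1%R, 2%R]) k%:E)).
  rewrite integral_cst//= lebesgue_measure_itv/= lte_fin ltr1n/=.
  by rewrite -EFinB -EFinM lte_fin mulr_gt0//; lra.
apply: (@le_trans _ _ (\int[mu]_(s in `[1%R, 2%R]) (s `^ (p - 1) * expR (- s))%:E)).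
  apply: ge0_le_integral => //.
  - by move=> x _; rewrite lee_fin ltW.
  - exact: mf.
  - move=> x; rewrite /= in_itv/= => /andP[x1 x2]; rewrite lee_fin.
    apply: ler_pM; rewrite ?expR_ge0//; last by rewrite ler_expR lerN2.
    rewrite /powR gt_eqF; last by lra.
    rewrite ler_expR.
    have l0 : (0 <= ln x)%R by rewrite ln_ge0.
    have l1 : (ln x <= 1)%R.
      have := @le_ln1Dx R (x - 1)%R.
      by rewrite (_ : 1 + (x - 1) = x)%R; [lra|ring].
    have := ler_norm (- (p - 1))%R; rewrite normrN; have := normr_ge0 (p - 1)%R; nra.
apply: ge0_subset_integral => //; first exact: mf.
by move=> x; rewrite /= !in_itv/=; lra.
Qed.

(** With $m = \lfloor p \rfloor$, splitting at $s = 1$ gives $s^{p-1} \le 1 + s^m$, so the integral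
    is dominated by the known value $\Gamma(1) + \Gamma(m+1)$. *)
Lemma Gamma_e_lty (p : R) : (1 <= p)%R -> Gamma_e p < +oo.
Proof.
move=> p1; pose m := Num.truncn p.
have pm : (p - 1 <= m%:R)%R by have := truncnS_gt p; rewrite -/m -natr1; lra.
apply: (@le_lt_trans _ _ (Gamma_e (1 : R) + Gamma_e (m.+1%:R : R))); last first.
  by rewrite !(Gamma_e1, Gamma_eS) -EFinD ltry.
have mf (q : R) D : measurable_fun D
    (fun s : R => (s `^ (q - 1) * expR (- s))%:E).
  apply/measurable_EFinP; apply: measurable_funM; first exact: measurable_fun_powR.
  exact: measurable_fun_expR.
have f0 (q s : R) : 0 <= (s `^ (q - 1) * expR (- s))%:E.
  by rewrite lee_fin mulr_ge0 ?powR_ge0 ?expR_ge0.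
rewrite /Gamma_e -ge0_integralD//; [|exact: mf|exact: mf].
apply: ge0_le_integral => //.
- exact: mf.
- by apply: emeasurable_funD; exact: mf.
- move=> s; rewrite /= in_itv/= andbT => s0.
  rewrite -EFinD lee_fin -mulrDl ler_wpM2r ?expR_ge0// subrr powRr0.
  rewrite -natr1 addrK.
  have [s1|s1] := leP s 1%R.
    apply: (@le_trans _ _ 1%R); last by rewrite lerDl powR_ge0.
    by rewrite -[leRHS](powRr0 s) ger_powR ?s0//; lra.
  apply: (@le_trans _ _ (s `^ m%:R)%R); last by rewrite lerDr.
  by rewrite ler_powR// ltW.
Qed.

(** Since $q \ge 1$, the factor $(1-v)^{q-1}$ is at most 1, and only the singularity at 0
    remains. *)
Lemma Beta_e_lty (p q : R) : (0 < p)%R -> (1 <= q)%R -> Beta_e p q < +oo.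
Proof.
move=> p0 q1; apply: le_lt_trans (ltry p^-1%R).
apply: le_trans (integral_powR_le p0); apply: ge0_le_integral => //.
- by move=> x x01; rewrite lee_fin mulr_ge0// powR_ge0.
- apply/measurable_EFinP; apply: measurable_funM; first exact: measurable_fun_powR.
  by apply: measurable_fun_powR; apply: measurable_funB.
- by apply/measurable_EFinP; exact: measurable_fun_powR.
- move=> v; rewrite /= in_itv/= => /andP[v0 v1]; rewrite lee_fin.
  rewrite ler_piMr ?powR_ge0// -[leRHS](powRr0 (1 - v)) ger_powR//.
    by rewrite subr_gt0 v1 lerBlDr lerDl ltW.
  by rewrite subr_ge0.
Qed.

End euler_values.

(** * Abel's integral over an interval *)

Section abel.
Context {R : realType}.
Local Notation mu := (@lebesgue_measure R).

(** For $a < 1$ the Gamma integrand is singular at 0. Finiteness comes from the product formula: an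
    infinite $\Gamma(a)$, times the positive $\Gamma(q)$, would make $B(a,q)\,n!$ infinite. *)
Lemma Gamma_e_fin_num (a q : R) (n : nat) : 0 < a -> 1 <= q ->
  a + q = n.+1%:R -> Gamma_e a \is a fin_num.
Proof.
move=> a0 q1 aq; rewrite ge0_fin_numE ?ltW ?Gamma_e_gt0//.
rewrite ltey; apply/eqP => aoo.
have := Gamma_eM a q; rewrite aq Gamma_eS aoo gt0_mulye ?Gamma_e_gt0// => h.
have : (Beta_e a q * n`!%:R%:E < +oo)%E.
  have : Beta_e a q \is a fin_num.
    rewrite ge0_fin_numE ?Beta_e_lty//.
    by apply: integral_ge0 => x _; rewrite lee_fin mulr_ge0// powR_ge0.
  by move=> /fineK <-; rewrite -EFinM ltry.
by rewrite -h.
Qed.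

(** All terms of the product formula are finite here, so $B(a,q)$ can be eliminated in favour of
    real Gamma values; the power of $s-t$ is an integer because $a+q$ is. *)
Lemma abel_integral (a q t s : R) (n : nat) : 0 < a -> 1 <= q ->
  a + q = n.+1%:R -> t < s ->
  (\int[mu]_(x in `]t, s[) ((x - t) `^ (a - 1) * (s - x) `^ (q - 1))%:E
   = (Gamma a * Gamma q / n`!%:R * (s - t) ^+ n)%:E)%E.
Proof.
move=> a0 q1 aq ts; rewrite Beta_e_itv// aq -[n.+1%:R]natr1 addrK.
rewrite powR_mulrn; last first.
  by rewrite subr_ge0 ltW.
have Bfin : Beta_e a q \is a fin_num.
  rewrite ge0_fin_numE ?Beta_e_lty//.
  by apply: integral_ge0 => x _; rewrite lee_fin mulr_ge0// powR_ge0.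
have Gafin := Gamma_e_fin_num a0 q1 aq.
have Gqfin : Gamma_e q \is a fin_num.
  by rewrite ge0_fin_numE ?ltW ?Gamma_e_gt0// Gamma_e_lty.
have := Gamma_eM a q; rewrite aq Gamma_eS.
rewrite -(fineK Bfin) -(fineK Gafin) -(fineK Gqfin) -!EFinM => -[].
rewrite -[fine (Gamma_e a)]/(Gamma a) -[fine (Gamma_e q)]/(Gamma q) => ->.
have nz : (n`!%:R : R) != 0 by rewrite pnatr_eq0 -lt0n fact_gt0.
by rewrite mulfK// mulrC.
Qed.

(** Finiteness matters because [fine] sends $+\infty$ to 0. *)
Lemma Gamma_gt0 (p : R) : Gamma_e p \is a fin_num -> 0 < Gamma p.
Proof.
move=> pfin; have := Gamma_e_gt0 p.
by rewrite -(fineK pfin) lte_fin.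
Qed.

Lemma GammaS (n : nat) : Gamma (n.+1%:R : R) = n`!%:R.
Proof. by rewrite -[LHS]/(fine (Gamma_e (n.+1%:R : R))) Gamma_eS. Qed.

End abel.

(** * Vector-valued integrals and fractional integrals of truncated powers *)

Section vector_integral.
Context {R : realType} {H : normedVectType R}.
Local Notation mu := (@lebesgue_measure R).

Lemma vint_scaler (D : set R) (k : R -> R) (f : H) : measurable D ->
  mu.-integrable D (EFin \o k) ->
  vint D (fun t => k t *: f) = (\int[mu]_(t in D) k t) *: f.
Proof.
move=> mD ik; rewrite /vint [in RHS](coord_vbasis (memvf f)) scaler_sumr.
apply: eq_bigr => i _; rewrite scalerA; congr (_ *: _).
by under eq_Rintegral do rewrite linearZ/=; rewrite RintegralZr.
Qed.

Lemma eq_vint (D : set R) (y z : R -> H) : {in D, y =1 z} -> vint D y = vint D z.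
Proof.
move=> yz; apply: eq_bigr => i _; congr (_ *: _).
by apply: eq_Rintegral => t tD; rewrite yz.
Qed.

Lemma integral_subset_supp (D E : set R) (k : R -> \bar R) : E `<=` D ->
  (forall x, D x -> ~ E x -> k x = 0%E) ->
  (\int[mu]_(x in D) k x = \int[mu]_(x in E) k x)%E.
Proof.
move=> ED k0; rewrite [LHS]integral_mkcond [RHS]integral_mkcond.
apply: eq_integral => x _; rewrite !patchE.
have [xE|xE] := boolP (x \in E).
  by rewrite (mem_set (ED _ (set_mem xE))).
case: ifPn => // /set_mem xD; apply: k0 => // /mem_set xE'.
by rewrite xE' in xE.
Qed.

(** The order [a] completes [beta] to an integer. The integrand lives on $]t,s[$, where Abel's
    integral yields a truncated polynomial that integer-order derivatives can handle. *)
Lemma frac_int_power (a beta b s : R) (n : nat) (y : R -> H) (f : H) (t : R) :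
  0 <= a -> 0 < beta -> a + beta = n%:R -> s < b -> 0 < t -> t < b ->
  (forall tau, 0 < tau -> y tau = (Num.max 0 (s - tau)) `^ beta *: f) ->
  frac_int a b y t = (Gamma (beta + 1) / n`!%:R * (Num.max 0 (s - t)) ^+ n) *: f.
Proof.
move=> a0 beta0 abn sb t0 tb yE; rewrite /frac_int.
(* At order 0 [frac_int] is the identity, $\beta = n$, and the coefficient $\Gamma(n+1)/n!$ is 1. *)
have [a_eq0|a_neq0] := eqVneq a 0.
  have bn : beta = n%:R by rewrite -abn a_eq0 add0r.
  have nz : (n`!%:R : R) != 0 by rewrite pnatr_eq0 -lt0n fact_gt0.
  by rewrite yE// bn natr1 GammaS powR_mulrn ?le_max ?lexx// divff// mul1r.
have a_gt0 : 0 < a by rewrite lt_neqAle eq_sym a_neq0.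
have q1 : 1 <= beta + 1 by rewrite lerDr ltW.
have aq : a + (beta + 1) = n.+1%:R by rewrite addrA abn natr1.
pose k (x : R) := (x - t) `^ (a - 1) * Num.max 0 (s - x) `^ beta.
rewrite (@eq_vint _ _ (fun x => k x *: f)); last first.
  move=> x; rewrite inE/= in_itv/= => /andP[tx _].
  by rewrite yE ?(lt_trans t0)// scalerA.
have mk : measurable_fun `]t, b[ k.
  apply: measurable_funM; apply: measurable_fun_powR; first exact: measurable_funB.
  by apply: measurable_maxr => //; exact: measurable_funB.
have kE : (\int[mu]_(x in `]t, b[) (k x)%:E =
   (Gamma a * Gamma (beta + 1) / n`!%:R * Num.max 0 (s - t) ^+ n)%:E)%E.
  have [ts|st] := ltP t s; last first.
    rewrite integral0_eq; last first.
      move=> x; rewrite /= in_itv/= => /andP[tx _].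
      rewrite /k max_l ?powR0 ?mulr0 ?gt_eqF//; lra.
    (* The right-hand side contains $0^n$, which is 0 only for $n > 0$. *)
    have n0 : (0 < n)%N by rewrite -(ltr0n R) -abn; lra.
    by rewrite max_l ?expr0n ?gtn_eqF ?mulr0//; lra.
  rewrite (@integral_subset_supp _ `]t, s[).
  - rewrite max_r; last lra.
    rewrite -(abel_integral a_gt0 q1 aq ts); apply: eq_integral => x.
    rewrite inE/= in_itv/= => /andP[tx xs].
    by rewrite /k max_r ?addrK//; lra.
  - by move=> x; rewrite /= !in_itv/= => /andP[-> xs]; lra.
  - move=> x; rewrite /= !in_itv/= => /andP[tx xb]; rewrite tx/= => /negP.
    by rewrite -leNgt => sx; rewrite /k max_l ?powR0 ?mulr0 ?gt_eqF//; lra.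
have ik : mu.-integrable `]t, b[ (EFin \o k).
  apply/integrableP; split; first exact/measurable_EFinP.
  under eq_integral do rewrite /= ger0_norm ?mulr_ge0 ?powR_ge0//.
  by rewrite kE ltry.
rewrite vint_scaler// /Rintegral kE/= scalerA; congr (_ *: _).
rewrite -!mulrA mulKf// gt_eqF//; apply: Gamma_gt0.
exact: Gamma_e_fin_num aq.
Qed.

End vector_integral.

(** * Taylor's formula with integral remainder *)

Section taylor.
Context {R : realType}.
Local Notation mu := (@lebesgue_measure R).

(** Integration by parts lowers the degree of $(s-t)^n$; the boundary terms vanish because this
    polynomial is zero at [s] and every derivative of [g] is zero at 0. Carrying an explicit
    primitive keeps integrals out of the induction. *)
Lemma taylor_primitive (g : R -> R) (s : R) (n : nat) :
  (forall k t, derivable (derive1n k g) t 1) -> (forall k, derive1n k g 0 = 0) ->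
  exists G : R -> R,
    [/\ forall t : R, is_derive t 1 G ((s - t) ^+ n * derive1n n.+1 g t),
        G s = n`!%:R * g s & G 0 = 0].
Proof.
move=> dg g0; elim: n => [|n [G [dG Gs G0]]].
  exists g; split; last exact: (g0 0%N).
    move=> t; rewrite expr0 mul1r derive1n1 derive1E.
    by apply: derivableP; exact: (dg 0%N).
  by rewrite mul1r.
(* one more integration by parts *)
exists (fun t => (s - t) ^+ n.+1 * derive1n n.+1 g t + n.+1%:R * G t); split.
- move=> t; have dgt : is_derive t 1 (derive1n n.+1 g) (derive1n n.+2 g t).
    by rewrite [derive1n n.+2 g]derive1nS derive1E; exact: derivableP.
  have dp : is_derive t 1 (fun t : R => (s - t) ^+ n.+1) (- (n.+1%:R * (s - t) ^+ n)).
    rewrite (_ : (fun t : R => (s - t) ^+ n.+1) = (fun t : R => s - t) ^+ n.+1);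
      last first.
      by apply/funext => x; rewrite exprfctE.
    by apply: is_derive_eq; rewrite add0r mul1r scalerN /GRing.scale/= mulr1.
  have dM := is_deriveM dp dgt.
  have dN := @is_deriveZ _ _ _ _ n.+1%:R _ _ _ (dG t).
  apply: (is_derive_congr (is_deriveD dM dN)).
  by rewrite /GRing.scale/=; ring.
- by rewrite subrr expr0n mul0r add0r Gs factS natrM mulrA.
- by rewrite g0 G0 !mulr0 addr0.
Qed.

(** Only the remainder is left in Taylor's formula, since the Taylor polynomial of [g] at 0 is
    zero. *)
Lemma taylor_integral (g : R -> R) (s : R) (n : nat) : 0 < s ->
  (forall k t, derivable (derive1n k g) t 1) -> (forall k, derive1n k g 0 = 0) ->
  (\int[mu]_(t in `[0%R, s]) ((s - t) ^+ n * derive1n n.+1 g t)%:E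
   = (n`!%:R * g s)%:E)%E.
Proof.
move=> s0 dg g0; have [G [dG <- G0]] := taylor_primitive s n dg g0.
transitivity (G s - G 0)%:E; last by rewrite G0 subr0.
apply: (@is_derive_FTC2 R G) => // t _ _.
apply: continuousM.
  apply: (@continuous_comp _ _ _ (fun x : R => s - x) (fun x : R => x ^+ n)).
    by apply: continuousB; [exact: cst_continuous|exact: cvg_id].
  exact: (@exprn_continuous R n).
by apply: differentiable_continuous; apply/derivable1_diffP; exact: dg.
Qed.

Lemma iter_distr_deriv (V : lmodType R) (n : nat) (S : distr V) (psi : R -> R) :
  iter n (@distr_deriv R V) S psi = (-1) ^+ n *: S (derive1n n psi).
Proof.
elim: n psi => [|n IH] psi; first by rewrite expr0 scale1r.
by rewrite iterS /distr_deriv IH -derive1Sn exprS mulN1r scaleNr.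
Qed.

End taylor.

(** * Smoothness of products of powers and test functions *)

Section smoothness.
Context {R : realType}.

Lemma closure_supp_near (psi : R -> R) (t : R) :
  ~ closure [set t | psi t != 0] t <-> \forall x \near t, psi x = 0.
Proof.
split=> [tN|].
  have : open (~` closure [set t | psi t != 0]).
    exact/closed_openC/closed_closure.
  rewrite openE => /(_ t tN); apply: filterS => x xN.
  by apply/eqP/negPn/negP => x0; apply: xN; apply: subset_closure.
by move=> n0 /(_ _ n0)[x [/= + x0]]; rewrite x0 eqxx.
Qed.

Lemma near0_derive1 (psi : R -> R) (t : R) :
  (\forall x \near t, psi x = 0) -> \forall x \near t, derive1 psi x = 0.
Proof.
move=> /near_join; apply: filterS => x n0.
by rewrite derive1E (@near_eq_derive _ _ _ _ (cst 0)) ?derive_cst.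
Qed.

(** Differentiation cannot enlarge the support, and a closed subset of a compact set is compact. *)
Lemma test_function_deriv (b : R) (psi : R -> R) :
  test_function b psi -> test_function b (derive1 psi).
Proof.
move=> [dpsi cpsi spsi].
have sub : closure [set t | derive1 psi t != 0] `<=` closure [set t | psi t != 0].
  move=> t; apply: contraPP => /closure_supp_near n0.
  exact/closure_supp_near/near0_derive1.
split.
- by move=> n t; have := dpsi n.+1 t; rewrite derive1Sn.
- by apply: subclosed_compact cpsi sub; exact: closed_closure.
- exact: subset_trans sub spsi.
Qed.

Lemma test_function_near0 (b : R) (psi : R -> R) (t : R) : test_function b psi ->
  t <= 0 -> \forall x \near t, psi x = 0.
Proof.
move=> [_ _ spsi] t0.
apply/closure_supp_near => /spsi; rewrite /= in_itv/= ltNge t0//.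
Qed.

(** The power may be singular at 0, but [psi] vanishes near every $t \le 0$, so both the product and
    the stated derivative are zero there. *)
Lemma is_derive_powR_test (b p : R) (psi : R -> R) (t : R) : test_function b psi ->
  is_derive t 1 (fun x => x `^ p * psi x)
    (p * (t `^ (p - 1) * psi t) + t `^ p * derive1 psi t).
Proof.
move=> psiP; have [dpsi _ _] := psiP.
have [t0|t0] := leP t 0.
  have n0 := test_function_near0 psiP t0.
  have psi't : derive1 psi t = 0.
    rewrite derive1E (@near_eq_derive _ _ _ _ (cst 0)) ?derive_cst//.
  rewrite (nbhs_singleton n0) psi't !mulr0 addr0.
  apply: (@near_eq_is_derive _ _ _ (cst 0)) => //.
  by apply: filterS n0 => x /= ->; rewrite mulr0.
have d1 := is_derive1_powR p t0.
have d2 : is_derive t 1 psi (derive1 psi t).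
  by rewrite derive1E; apply: derivableP; exact: (dpsi 0%N).
apply: (is_derive_congr (is_deriveM d1 d2)).
by rewrite /GRing.scale/=; ring.
Qed.

(** Orders are bounded by [n] because the strong induction in [derivable_powR_test] supplies no
    more. *)
Lemma derivable_derive1n_combine (n : nat) (F G : R -> R) (a : R) :
  (forall k t, (k <= n)%N -> derivable (derive1n k F) t 1) ->
  (forall k t, (k <= n)%N -> derivable (derive1n k G) t 1) ->
  forall t, derivable (derive1n n (fun x => a * F x + G x)) t 1.
Proof.
move=> dF dG; set C := fun x => _.
have step k (t : R) : (k <= n)%N ->
    derive1n k C = (fun x => a * derive1n k F x + derive1n k G x) ->
    is_derive t 1 (derive1n k C) (a * derive1n k.+1 F t + derive1n k.+1 G t).
  move=> kn ->.
  have h1 : is_derive t 1 (derive1n k F) (derive1n k.+1 F t).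
    by rewrite derive1nS derive1E; apply: derivableP; exact: dF.
  have h2 : is_derive t 1 (derive1n k G) (derive1n k.+1 G t).
    by rewrite derive1nS derive1E; apply: derivableP; exact: dG.
  exact: (is_derive_congr (is_deriveD (@is_deriveZ _ _ _ _ a _ _ _ h1) h2)).
have CE k : (k <= n)%N ->
    derive1n k C = (fun x => a * derive1n k F x + derive1n k G x).
  elim: k => [//|k IH] kn; apply/funext => t; rewrite derive1nS derive1E.
  by have [_ ->] := step k t (ltnW kn) (IH (ltnW kn)).
by move=> t; have [] := step n t (leqnn n) (CE n (leqnn n)).
Qed.

(** One derivative gives $p x^{p-1}\psi + x^p\psi'$, a combination of products of the same shape;
    the induction therefore runs over all [p] and [psi] at once. *)
Lemma derivable_powR_test (b : R) (n : nat) (p : R) (psi : R -> R) (t : R) :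
  test_function b psi ->
  derivable (derive1n n (fun x => x `^ p * psi x)) t 1.
Proof.
elim/ltn_ind: n p psi t => -[|n] IH p psi t psiP.
  by have [] := is_derive_powR_test p t psiP.
rewrite derive1Sn.
rewrite (_ : derive1 (fun x => x `^ p * psi x) =
  (fun x => p * (x `^ (p - 1) * psi x) + x `^ p * derive1 psi x)); last first.
  apply/funext => x; rewrite derive1E.
  by have [_ ->] := is_derive_powR_test p x psiP.
apply: (@derivable_derive1n_combine n (fun x => x `^ (p - 1) * psi x)
  (fun x => x `^ p * derive1 psi x)) => // k {}t kn; apply: IH => //.
exact: test_function_deriv psiP.
Qed.

Lemma derive1n_powR_test0 (b : R) (n : nat) (p : R) (psi : R -> R) :
  test_function b psi -> derive1n n (fun x => x `^ p * psi x) 0 = 0.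
Proof.
move=> psiP.
(* A value at one point does not pass to derivatives; vanishing on a neighbourhood does. *)
suff : \forall x \near (0 : R), derive1n n (fun x => x `^ p * psi x) x = 0.
  exact: nbhs_singleton.
elim: n => [|n IH].
  apply: filterS (test_function_near0 psiP (lexx 0)) => x.
  by rewrite derive1n0 => ->; rewrite mulr0.
by rewrite derive1nS; exact: near0_derive1.
Qed.

End smoothness.

(** * Derivatives of truncated powers and of vector-valued curves *)

Section extinction.
Context {R : realType}.

Lemma powR_max0_cvg0 (p : R) : 0 < p ->
  (fun h : R => h^-1 * Num.max 0 h `^ (p + 1)) @ 0^' --> (0 : R).
Proof.
move=> p0; apply: (@cvg_at_right_left_dnbhs _ R^o).
  apply: cvg_trans (powR_cvg0 p0); apply: near_eq_cvg.
  near=> h; have h0 : 0 < h by near: h; exact: nbhs_right_gt.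
  rewrite max_r ?ltW// powRD ?(gt_eqF h0) ?implybT// powRr1 ?ltW//.
  by rewrite mulrCA mulVf ?gt_eqF// mulr1.
have c0 : cst (0 : R) @ (0 : R)^'- --> (0 : R) by exact: cvg_cst.
apply: cvg_trans c0; apply: near_eq_cvg.
near=> h; have h0 : h < 0 by near: h; exact: nbhs_left_lt.
by rewrite max_l ?ltW// powR0 ?mulr0// gt_eqF//; lra.
Unshelve. all: by end_near. Qed.

(** At the junction 0 the difference quotient is $h_+^p/h$, which tends to 0 because $p > 1$. This
    keeps the explicit solution differentiable at its extinction. *)
Lemma is_derive_powR_max0 (p x : R) : 1 < p ->
  is_derive x 1 (fun y => Num.max 0 y `^ p) (p * Num.max 0 x `^ (p - 1)).
Proof.
move=> p1; have [x0|x0|->] := ltgtP x 0.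
- rewrite powR0 ?mulr0; last by rewrite gt_eqF//; lra.
  apply: (@near_eq_is_derive _ _ _ (cst 0)) => //.
  near=> y; have y0 : y < 0 by near: y; exact: lt_nbhsl.
  by rewrite /= max_l ?ltW// powR0// gt_eqF//; lra.
- have h := is_derive1_powR p x0.
  apply: (@near_eq_is_derive _ _ _ (@powR R ^~ p)) => //.
  near=> y; have y0 : 0 < y by near: y; exact: lt_nbhsr.
  by rewrite /= max_r ?ltW.
- rewrite powR0 ?mulr0; last by rewrite gt_eqF//; lra.
  have p10 : 0 < p - 1 by lra.
  have h : h^-1 *: (((fun y => Num.max 0 y `^ p) \o shift (0 : R)) (h *: (1 : R)) -
      Num.max 0 (0 : R) `^ p) @[h --> (0 : R)^'] --> (0 : R).
    rewrite maxxx powR0; last by rewrite gt_eqF//; lra.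
    under eq_fun do rewrite /= addr0 subr0 /GRing.scale/= mulr1.
    by have := powR_max0_cvg0 p10; rewrite subrK.
  by split; [exact: cvgP h|exact: cvg_lim h].
Unshelve. all: by end_near. Qed.

Lemma is_derive_scalerl (V : normedModType R) (k : R -> R) (w : V) (t dk : R) :
  is_derive t 1 k dk -> is_derive t 1 (fun x => k x *: w) (dk *: w).
Proof.
move=> [dkt <-].
have h : h^-1 *: (((fun x => k x *: w) \o shift t) (h *: (1 : R)) - k t *: w)
    @[h --> (0 : R)^'] --> ('D_1 k t) *: w.
  under eq_fun do rewrite /= -scalerBl scalerA.
  exact: cvgZr_tmp.
by split; [exact: cvgP h|exact: cvg_lim h].
Qed.

Lemma is_derive_right (V : normedModType R) (v : R -> V) (dv : V) (a : R) :
  is_derive a 1 v dv -> h^-1 *: (v (h + a) - v a) @[h --> 0^'+] --> dv.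
Proof.
move=> [dva <-]; apply: cvg_dnbhs_at_right.
have : h^-1 *: ((v \o shift a) (h *: (1 : R)) - v a) @[h --> (0 : R)^'] --> 'D_1 v a.
  exact: dva.
by under eq_fun do rewrite /= [_ *: 1]mulr1.
Qed.

End extinction.

(** * The transform of a truncated power *)

Section transform_of_power.
Context {R : realType} {H : normedVectType R}.
Local Notation mu := (@lebesgue_measure R).

Lemma derive1nZ (F : R -> R) (a : R) (n : nat) :
  (forall k t, derivable (derive1n k F) t 1) ->
  derive1n n (fun x => a * F x) = (fun x => a * derive1n n F x).
Proof.
move=> dF; elim: n => [//|n IH]; rewrite derive1nS IH.
apply/funext => t; rewrite derive1E derive1nS derive1E.
have h : is_derive t 1 (derive1n n F) ('D_1 (derive1n n F) t).
  exact/derivableP/dF.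
by have [_ ->] := @is_deriveZ _ _ _ _ a _ _ _ h.
Qed.

Lemma integrable_continuous_itvcc (a b : R) (k : R -> R) : continuous k ->
  mu.-integrable `[a, b] (EFin \o k).
Proof.
move=> ck; apply: continuous_compact_integrable; first exact: segment_compact.
exact: continuous_subspaceT.
Qed.

Lemma integrable_continuous_itvoo (a b : R) (k : R -> R) : continuous k ->
  mu.-integrable `]a, b[ (EFin \o k).
Proof.
move=> ck; apply: integrableS (integrable_continuous_itvcc a b ck) => //.
exact: subset_itv_oo_cc.
Qed.

(** By duality all $n+1$ derivatives fall on $F(x) = x^\beta\psi(x)$, while the fractional integral
    turns [u] into a multiple of $(s-t)_+^n$; Taylor's remainder formula then returns $F(s)$. *)
Lemma p_transform_power (beta b s : R) (u : R -> H) (w : H) (psi : R -> R) :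
  1 < beta -> 0 < s -> s < b ->
  (forall tau, 0 < tau -> u tau = Num.max 0 (s - tau) `^ beta *: w) ->
  test_function b psi -> p_transform beta b u psi = (s `^ beta * psi s) *: w.
Proof.
move=> beta1 s0 sb uE psiP.
(* [frac_deriv] differentiates $n+1 = \lceil\beta+1\rceil$ times, so its fractional integral has
   order $a = (n+1)-(\beta+1) = n-\beta$. *)
have [n [a [NE aE a0 n0]]] : exists n a, [/\ `|Num.ceil (beta + 1)|%N = n.+1,
    a + beta = n%:R, 0 <= a & (0 < n)%N].
  have c0 : (0 <= Num.ceil (beta + 1))%R by rewrite ceil_ge0; lra.
  have := ceil_ge (beta + 1); rewrite -(gez0_abs c0).
  case: `|Num.ceil (beta + 1)|%N => [|n] /= h.
    by move: h; rewrite mulr0z; lra.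
  exists n, (n%:R - beta); split; rewrite ?subrK//.
    by move: h; rewrite -[X in _ <= X]/(n.+1%:R) -natr1; lra.
  by rewrite -(ltr0n R); move: h; rewrite -[X in _ <= X]/(n.+1%:R) -natr1; lra.
set F := fun x => x `^ beta * psi x.
have dF k t : derivable (derive1n k F) t 1 by exact: derivable_powR_test psiP.
have F0 k : derive1n k F 0 = 0 by exact: derive1n_powR_test0 psiP.
set G := Gamma (beta + 1).
have G0 : 0 < G.
  apply: Gamma_gt0; rewrite ge0_fin_numE ?ltW ?Gamma_e_gt0//.
  by apply: Gamma_e_lty; lra.
have nf : (n`!%:R : R) != 0 by rewrite pnatr_eq0 -lt0n fact_gt0.
rewrite /p_transform /distr_mul /frac_deriv NE /distr_scale iter_distr_deriv.
(* The sign in [frac_deriv] and the one from moving the derivatives onto the test function are both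
   $(-1)^{n+1}$ and cancel. *)
rewrite scalerA -exprMn mulrNN mulr1 expr1n scale1r.
rewrite (_ : (fun t => _) = (fun t => G^-1 * F t)); last first.
  by apply/funext => t; rewrite /F mulrA; congr (_ * _); rewrite mulrC.
rewrite derive1nZ// /distr_of_fun.
pose k (t : R) : R := n`!%:R^-1 * (Num.max 0 (s - t) ^+ n * derive1n n.+1 F t).
rewrite (@eq_vint _ _ _ _ (fun t => k t *: w)); last first.
  move=> t; rewrite inE/= in_itv/= => /andP[t0 tb].
  rewrite (@frac_int_power _ _ _ beta b s n _ w)//; last 3 first.
  - by rewrite -[n.+1%:R]natr1 -aE; lra.
  - by lra.
  - by rewrite -[n.+1%:R]natr1; lra.
  rewrite scalerA /k -/G; congr (_ *: _).
  rewrite -derive1nS; move: (_ ^+ n) (derive1n n.+1 F t) (n`!%:R) nf => x y z nz.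
  by field; rewrite nz gt_eqF.
have ck : continuous k.
  move=> t; apply: (@continuousM _ _ (fun=> n`!%:R^-1)
    (fun t => Num.max 0 (s - t) ^+ n * derive1n n.+1 F t)).
    exact: cst_continuous.
  apply: (@continuousM _ _ (fun t => Num.max 0 (s - t) ^+ n) (derive1n n.+1 F)).
    apply: (@continuous_comp _ _ _ (fun x : R => Num.max 0 (s - x))
      (fun x : R => x ^+ n)).
      apply: continuous_max; first exact: cst_continuous.
      by apply: continuousB; [exact: cst_continuous|exact: cvg_id].
    exact: (@exprn_continuous R n).
  by apply: differentiable_continuous; apply/derivable1_diffP; exact: dF.
rewrite vint_scaler//; last exact: integrable_continuous_itvoo.
suff -> : \int[mu]_(t in `]0, b[) k t = F s.
  by [].
(* Beyond [s] the truncated power is zero, as $n > 0$; the endpoints are then added to reach the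
   closed interval of [taylor_integral]. *)
rewrite /Rintegral (@integral_subset_supp _ _ `]0, s[); last 2 first.
- by move=> x; rewrite /= !in_itv/= => /andP[-> xs]; lra.
- move=> x; rewrite /= !in_itv/= => /andP[x0 xb]; rewrite x0/= => /negP.
  rewrite -leNgt => sx; rewrite /k max_l; last lra.
  by rewrite expr0n gtn_eqF// mul0r mulr0.
rewrite integral_itv_obnd_cbnd; last first.
  by apply/measurable_EFinP; apply: measurable_funTS; exact: continuous_measurable_fun.
rewrite integral_itv_bndo_bndc; last first.
  by apply/measurable_EFinP; apply: measurable_funTS; exact: continuous_measurable_fun.
have h : (n`!%:R%:E * \int[mu]_(x in `[0%R, s]) (k x)%:E = (n`!%:R * F s)%:E)%E.
  rewrite -(taylor_integral n s0 dF F0) -integralZl//; last first.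
    exact: integrable_continuous_itvcc.
  apply: eq_integral => x; rewrite inE/= in_itv/= => /andP[x0 xs].
  by rewrite -EFinM /k max_r ?subr_ge0// mulVKf.
by rewrite -[X in fine X]mul1e -(mulVf nf) EFinM -muleA h -EFinM/= mulKf.
Qed.

End transform_of_power.

(** * Sign of the eigenvalue and the explicit solution *)

Section eigenfunction.
Context {R : realType} {H : normedVectType R}.

(** Coercivity tested on [f] itself reads $0 < \|f\|^{\gamma+1} \le -C\lambda\|f\|^2$. *)
Lemma eigenvalue_lt0 (ip : {dot H for idfun}) (gamma : R) (X : set H)
    (P : H -> H) (f : H) (lambda : R) :
  norm_of ip -> coercive ip gamma X P -> ortho_compl ip X (op_kernel X P) f ->
  is_eigenfunction P f lambda -> lambda < 0.
Proof.
move=> ipn [C C0 coer] fo [f0 Pf].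
have := coer f fo; rewrite Pf linearNl linearZl_LR/= -ipn.
have nf : 0 < `|f| by rewrite normr_gt0.
have := powR_gt0 (gamma + 1) nf; have := exprn_gt0 2 nf.
rewrite /GRing.scale/= => h1 h2 h3.
have : 0 < C * - (lambda * `|f| ^+ 2) by exact: lt_le_trans h2 h3.
by rewrite pmulr_rgt0// oppr_gt0 pmulr_llt0.
Qed.

(** A curve $a(t)f$ with $a \ge 0$ solves the flow when $a' = \lambda a^\gamma$, and $a(t) =
    (1-ct)_+^\beta$ does because $\beta\gamma = \beta-1$ and $\lambda = -\beta c$. Writing it with
    $c^{-1}-t$ matches [p_transform_power]. *)
Lemma eigen_solution (gamma beta : R) (X : set H) (P : H -> H) (f : H)
    (lambda : R) :
  0 < gamma -> gamma < 1 -> beta = 1 / (1 - gamma) -> homogeneous gamma X P ->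
  X f -> P f = lambda *: f -> lambda < 0 ->
  let c := (gamma - 1) * lambda in
  is_solution X P (fun t => Num.max 0 (c^-1 - t) `^ beta *: (c `^ beta *: f)).
Proof.
move=> g0 g1 betaE hom Xf Pf l0 c.
have c0 : 0 < c by rewrite /c nmulr_lgt0//; lra.
have beta1 : 1 < beta.
  by rewrite betaE div1r invf_gt1; lra.
have bg : beta * gamma = beta - 1.
  by rewrite betaE; field; rewrite gt_eqF//; lra.
have lE : lambda = - beta * c.
  by rewrite betaE /c; field; rewrite gt_eqF//; lra.
clearbody c; set v := fun t => _.
have m0 t : 0 <= Num.max 0 (c^-1 - t) by rewrite le_max lexx.
have vE t : v t = (Num.max 0 (c^-1 - t) * c) `^ beta *: f.
  by rewrite /v scalerA powRM// ltW.
have dv (t : R) : is_derive t 1 v (P (v t)).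
  have d1 := @is_derive_powR_max0 R beta (c^-1 - t) beta1.
  have d2 : is_derive t 1 (fun x : R => c^-1 - x) (-1).
    by apply: is_derive_eq; rewrite add0r mul1r.
  have d3 := @is_derive1_comp R (fun y => Num.max 0 y `^ beta)
    (fun x => c^-1 - x) t _ _ d1 d2.
  apply: (is_derive_congr (is_derive_scalerl (c `^ beta *: f) d3)).
  rewrite vE; set m := Num.max 0 (c^-1 - t).
  have [_ ->] := hom ((m * c) `^ beta) f Xf.
  (* For $a = (mc)^\beta$ the factor $a|a|^{\gamma-1}$ collapses to $a^\gamma = (mc)^{\beta-1}$, at
     $a = 0$ too because $\gamma > 0$. *)
  rewrite ger0_norm ?powR_ge0// mulr_powRB1 ?powR_ge0// Pf !scalerA -powRrM bg.
  congr (_ *: _); rewrite powRM ?m0 ?ltW// lE -(@mulr_powRB1 _ c beta) ?ltW//; last lra.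
  by ring.
split.
- by move=> t _; rewrite vE; have [] := hom ((Num.max 0 (c^-1 - t) * c) `^ beta) f Xf.
- have := is_derive_right (dv 0); under eq_fun do rewrite addr0; exact.
- by move=> t _; exact: dv.
Qed.

End eigenfunction.

(** * The transform of an eigenfunction *)

Unset Implicit Arguments.
Set Strict Implicit.

Theorem theorem2 (R : realType) (H : normedVectType R)
    (ip : {dot H for idfun}) (ip_norm : norm_of ip)
    (X : set H) (gamma beta : R)
    (gamma_gt0 : 0 < gamma) (gamma_lt1 : gamma < 1)
    (betaE : beta = 1 / (1 - gamma))
    (P : H -> H)
    (P_hom : homogeneous gamma X P)
    (P_coer : coercive ip gamma X P)
    (NP_max : maximally_monotone ip X (fun v => - P v))
    (X0 : X 0) (P0 : P 0 = 0)
    (P_wp : well_posed X P)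
    (P_mass : mass_preserving ip X P)
    (f : H) (lambda : R)
    (f_ortho : ortho_compl ip X (op_kernel X P) f)
    (f_eigen : is_eigenfunction P f lambda)
    (u : R -> H) (u_sol : is_solution X P u) (u0 : u 0 = f)
    (T b : R) (T_ext : is_extinction_time u T) (b_gt : T < b) :
  let c := (gamma - 1) * lambda in
  eq_distr b
    (p_transform beta b u)
    (distr_vec f
       (distr_mul (fun t => t `^ beta * c `^ (beta + 1)) (dirac_1sub c))).
Proof.
move=> c psi psiP.
have l0 := eigenvalue_lt0 ip_norm P_coer f_ortho f_eigen.
have [Xf _] := f_ortho; have [f0 Pf] := f_eigen.
have v_sol := eigen_solution gamma_gt0 gamma_lt1 betaE P_hom Xf Pf l0.
have c0 : 0 < c by rewrite /c nmulr_lgt0//; lra.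
have beta1 : 1 < beta by rewrite betaE div1r invf_gt1; lra.
(* This normalisation gives the explicit solution the initial value [f]. *)
have cV : c^-1 `^ beta * c `^ beta = 1.
  by rewrite -powRM ?invr_ge0 ?ltW// mulVf ?gt_eqF// powR1.
have [_ uniq_sol] := P_wp f Xf.
have uE t : 0 <= t -> u t = Num.max 0 (c^-1 - t) `^ beta *: (c `^ beta *: f).
  move=> t0; apply: uniq_sol u_sol v_sol u0 _ t t0.
  by rewrite subr0 max_r ?invr_ge0 ?ltW// scalerA cV scale1r.
(* Before time $1/c$ the solution is a positive multiple of [f], on which [P] does not vanish by
   homogeneity; the zero derivative at [T] therefore forces $1/c \le T$. *)
have sT : c^-1 <= T.
  have [[T0 /(_ T (lexx T)) uT] _] := T_ext.
  have [_ _ /(_ T T0)[_]] := u_sol; rewrite -derive1E uT (uE T (ltW T0)) scalerA.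
  set a := _ * _ => Pu; rewrite leNgt; apply/negP => Ts.
  have a0 : 0 < a.
    by rewrite mulr_gt0 ?powR_gt0// lt_max subr_gt0 Ts orbT.
  clearbody a; have [_] := P_hom a f Xf; rewrite -Pu Pf scalerA => /esym/eqP.
  rewrite scaler_eq0 (negbTE f0) orbF !mulf_eq0 (gt_eqF a0) (lt_eqF l0) orbF/=.
  by rewrite gt_eqF// powR_gt0// normr_gt0 gt_eqF.
rewrite (@p_transform_power _ _ beta b c^-1 u (c `^ beta *: f))//; last 3 first.
- by rewrite invr_gt0.
- exact: le_lt_trans sT b_gt.
- by move=> t /ltW; exact: uE.
rewrite /distr_vec /distr_mul /dirac_1sub /distr_scale /dirac_at scalerA.
(* The prefactor $1/c$ of the Dirac mass absorbs one of the $\beta+1$ powers of [c]. *)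
congr (_ *: _); rewrite powRD ?(gt_eqF c0) ?implybT// powRr1 ?ltW//.
by rewrite /GRing.scale/=; field; rewrite gt_eqF.
Qed.
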